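(* Let $L$ be an infinitely distributive lattice and let $Y$ be a regular sublattice of $L$. Then for every $A\subseteq Y$: (i) $A^{\sigma_Y}=A^{\sigma_L}\cap Y$; and (ii) $\bigl(A^{\sigma_Y}\bigr)^{\sigma_L}=A^{\sigma_L}$.
   Context: A lattice $L$ is infinitely distributive if whenever $\bigvee A$ exists, $x\wedge\bigvee A=\bigvee_{a\in A}(x\wedge a)$ for every $x\in L$, and whenever $\bigwedge A$ exists, $x\vee\bigwedge A=\bigwedge_{a\in A}(x\vee a)$ for every $x\in L$. A sublattice $Y$ of $L$ is regular in $L$ if every supremum or infimum of a subset of $Y$ that exists in $Y$ also exists in $L$, with the same value. For a lattice $K$ (here $K=Y$ or $K=L$), a net $(x_\gamma)$ in $K$ order converges to $x\in K$ if there are a directed set $M\subseteq K$ and a filtered (downward directed) set $N\subseteq K$ with $\bigvee M=x=\bigwedge N$ (computed in $K$) such that for every $(m,n)\in M\times N$ the net is eventually in the interval $[m,n]$ of $K$. A subset of $K$ is $O$-closed if it equals the set of all order limits in $K$ of nets in it. An (order) ideal of $K$ is a downset of $K$ closed under finite joins. For $A\subseteq K$, $A^{\sigma_K}$ is the smallest $O$-closed ideal of $K$ containing $A$. *)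

(* Defs.v *)
From mathcomp Require Import all_boot all_order.
From mathcomp Require Import boolp classical_sets cardinality.

Set Implicit Arguments.
Unset Strict Implicit.
Unset Printing Implicit Defensive.

Local Open Scope classical_set_scope.
Local Open Scope order_scope.

Definition infinitely_distributive (d : Order.disp_t) (L : latticeType d) : Prop :=
  (forall (A : set L) (s x : L), supremums A s ->
     supremums [set Order.meet x a | a in A] (Order.meet x s)) /\
  (forall (A : set L) (i x : L), infimums A i ->
     infimums [set Order.join x a | a in A] (Order.join x i)).

(* A sublattice of L is a type Y of class subLattice S d': its underlying subset
   of L is S, and val : Y -> L is an order embedding onto S that preserves meets
   and joins.  Suprema and infima of A : set Y are those computed in Y.  The set
   A may be empty: a least or greatest element of a regular Y is one of L. *)
Definition regular_sublattice (d : Order.disp_t) (L : latticeType d)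
    (S : {pred L}) (d' : Order.disp_t) (Y : subLattice S d') : Prop :=
  (forall (A : set Y) (s : Y), supremums A s ->
     supremums [set val a | a in A] (val s)) /\
  (forall (A : set Y) (i : Y), infimums A i ->
     infimums [set val a | a in A] (val i)).

Definition directed (T : Type) (R : T -> T -> Prop) (D : set T) : Prop :=
  D !=set0 /\
  forall x y, D x -> D y -> exists z, [/\ D z, R x z & R y z].

Definition directed_preorder (I : Type) (R : I -> I -> Prop) : Prop :=
  [/\ forall i, R i i,
      forall i j k, R i j -> R j k -> R i k &
      directed R [set: I]].

Section OrderConvergence.
Context {d : Order.disp_t} {K : latticeType d}.

Definition order_converges (I : Type) (R : I -> I -> Prop) (u : I -> K) (x : K)
    : Prop :=
  exists M N : set K,
    [/\ directed (fun a b => a <= b) M,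
        directed (fun a b => b <= a) N,
        supremums M x,
        infimums N x &
        forall m n, M m -> N n ->
          exists i0, forall i, R i0 i -> m <= u i <= n].

Definition order_limits (C : set K) : set K :=
  [set x | exists (I : Type) (R : I -> I -> Prop) (u : I -> K),
     [/\ directed_preorder R, forall i, C (u i) & order_converges R u x]].

Definition O_closed (C : set K) : Prop := C = order_limits C.

(* The family F may be empty, so an ideal contains the least element of K if
   there is one; if there is none, the empty set is an ideal. *)
Definition order_ideal (J : set K) : Prop :=
  (forall x y, J y -> x <= y -> J x) /\
  (forall (F : set K) (s : K),
     finite_set F -> F `<=` J -> supremums F s -> J s).

(* smallest is an intersection; both properties are stable under intersection. *)
Definition sigma_ideal (A : set K) : set K :=
  smallest [set J | O_closed J /\ order_ideal J] A.

End OrderConvergence.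

(* Main.v *)
Require Import Defs.
From mathcomp Require Import all_boot all_order.
From mathcomp Require Import boolp classical_sets.
From mathcomp Require cardinality.

Import Order.Theory.

Local Open Scope classical_set_scope.

(** Two observations turn the statement into a comparison of suprema.

    First, in any lattice the O-closed ideals are exactly the downsets closed
    under all existing suprema ([O_closed_idealP]): a supremum of a nonempty set
    is the limit of the increasing net of its finite joins, and conversely an
    order limit of a net in a downset [J] is the supremum of a set [M] whose
    members lie eventually below the net, hence in [J].

    Second, when meets distribute over existing suprema, the smallest such
    downset containing [A] is described by a single supremum
    ([sigma_ideal_meetP]): [x] belongs to it iff [x] is the supremum of the
    meets of [x] with the elements of [A].

    A regular sublattice inherits the distributive law
    ([regular_meet_distributive]), and for [x] and [A] in [Y] the criterion
    mentions only meets and one supremum of elements of [Y], on which [Y] and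
    [L] agree.  This gives (i).  For (ii), (i) places the image of the ideal
    generated in [Y] between the image of [A] and the ideal it generates in [L],
    so it generates the same ideal in [L]. *)

Section ClosedIdeals.
Local Open Scope order_scope.
Context {d : Order.disp_t} {K : latticeType d}.
Implicit Types (A B J : set K) (x y s : K).

Definition down_closed J := forall x y, J y -> x <= y -> J x.

Definition sup_closed J := forall B s, B `<=` J -> supremums B s -> J s.

Definition join_closed J := forall x y, J x -> J y -> J (Order.join x y).

Definition meet_distributive := forall A s x, supremums A s ->
  supremums [set Order.meet x a | a in A] (Order.meet x s).

Lemma ideal_join_closed J : order_ideal J -> join_closed J.
Proof.
move=> [_ finJ] x y Jx Jy.
apply: (finJ [set x; y]); first exact: cardinality.finite_set2.
- by move=> z [] ->.
- split=> [z [] ->|z ub]; [exact: leUl|exact: leUr|].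
  by rewrite leUx !ub //; [right|left].
Qed.

(** Lets a supremum of an arbitrary nonempty set be reached by a net: the finite
    joins of its elements are directed and have the same supremum.  They are
    generated as a smallest join-closed set, so that finite families need not be
    handled. *)
Lemma supremums_join_closure B s :
  supremums B s -> supremums (smallest join_closed B) s.
Proof.
move=> [ubs lbs]; split=> [|u ubu].
- by apply: smallest_sub => // x y /= xs ys; rewrite leUx xs.
- by apply: lbs => b Bb; apply: ubu; apply: sub_gen_smallest.
Qed.

Lemma join_closed_smallest B : join_closed (smallest join_closed B).
Proof.
move=> x y Bx By J JB.
by apply: JB.1; [apply: Bx|apply: By].
Qed.

Lemma join_closed_directed J :
  J !=set0 -> join_closed J -> directed (fun x y => x <= y) J.
Proof.
move=> J0 Jcl; split=> // x y Jx Jy; exists (Order.join x y).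
by split; [exact: Jcl|exact: leUl|exact: leUr].
Qed.

(** A directed set, indexed by itself, is a net; the set itself and the
    singleton of its supremum witness the convergence. *)
Lemma directed_sup_order_limit (D C : set K) s :
  directed (fun x y => x <= y) D -> D `<=` C -> supremums D s ->
  order_limits C s.
Proof.
move=> Ddir DC supD; have [[m0 Dm0] Dub] := Ddir.
exists {y | D y}, (fun i j => sval i <= sval j), sval; split.
- split=> [i|i j k|]; [exact: lexx|exact: le_trans|split].
    by exists (exist _ m0 Dm0).
  move=> [x Dx] [y Dy] _ _; have [z [Dz xz yz]] := Dub x y Dx Dy.
  by exists (exist _ z Dz).
- by move=> [y Dy]; apply: DC.
exists D, [set s]; split=> //.
- by split=> [|x y -> ->]; exists s.
- by split=> [z ->|z]; [exact: lexx|exact].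
- move=> m _ Dm ->; exists (exist _ m Dm) => -[y Dy] /= my.
  by rewrite my supD.1.
Qed.

(** Of the data of an order limit only the set approximating it from below
    matters: each of its members is below some term of the net. *)
Lemma order_limits_sub J :
  down_closed J -> sup_closed J -> order_limits J `<=` J.
Proof.
move=> Jdown Jsup x [I [R [u [[Rrefl _ _] Ju [M [N [_ Ndir supM _ ev]]]]]]].
apply: (Jsup M) => // m Mm; have [[n Nn] _] := Ndir.
have [i0 /(_ i0 (Rrefl i0)) /andP[mu _]] := ev m n Mm Nn.
exact: Jdown mu.
Qed.

Lemma O_closed_idealP J :
  (O_closed J /\ order_ideal J) <-> (down_closed J /\ sup_closed J).
Proof.
split=> [[Jlim Jideal]|[Jdown Jsup]].
- split; first exact: Jideal.1.
  move=> B s BJ supB.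
  (* The empty supremum is not a limit of a net; it is a finite join. *)
  have [B0|/set0P[b Bb]] := eqVneq B set0.
    apply: (Jideal.2 B) => //; rewrite B0; exact: cardinality.finite_set0.
  rewrite Jlim; apply: (@directed_sup_order_limit (smallest join_closed B)).
  + apply: join_closed_directed (join_closed_smallest B).
    by exists b; apply: sub_gen_smallest.
  + by apply: smallest_sub => //; apply: ideal_join_closed.
  + exact: supremums_join_closure.
- split; last by split=> // F s _; apply: Jsup.
  apply/seteqP; split; last exact: order_limits_sub.
  move=> x Jx; apply: (@directed_sup_order_limit [set x]).
  + by split=> [|y z -> ->]; exists x.
  + by move=> _ ->.
  + by rewrite supremums1.
Qed.

Lemma sigma_ideal_min A J :
  O_closed J -> order_ideal J -> A `<=` J -> sigma_ideal A `<=` J.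
Proof. by move=> ? ?; apply: smallest_sub. Qed.

(** The elements satisfying the criterion form a downset by distributivity, and
    they are closed under suprema because a common bound of the meets [s /\ a]
    bounds the meets [b /\ a] for each [b] below [s]. *)
Lemma sigma_ideal_meetP A x : meet_distributive ->
  sigma_ideal A x <-> supremums [set Order.meet x a | a in A] x.
Proof.
move=> distr; pose J := [set y | supremums [set Order.meet y a | a in A] y].
split=> [|supx]; last first.
  move=> C [/O_closed_idealP[Cdown Csup] AC]; apply: (Csup _ _ _ supx).
  by move=> _ [a Aa <-]; apply: Cdown (AC _ Aa) (leIr _ _).
have [Jclosed Jideal] : O_closed J /\ order_ideal J.
  apply/O_closed_idealP; split=> [y z Jz yz|B s BJ supB].
  - have := distr _ _ y Jz; rewrite /J/= image_comp (meet_l yz).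
    by under eq_imagel => a _ do rewrite /= meetA (meet_l yz).
  - split=> [_ [a _ <-]|u ubu]; first exact: leIl.
    apply: supB.2 => b Bb; apply: (BJ b Bb).2 => _ [a Aa <-].
    apply: le_trans (ubu _ _); last by exists a.
    by apply: leI2 => //; apply: supB.1.
apply: (@sigma_ideal_min A J) => // a Aa.
split=> [_ [b _ <-]|u ubu]; first exact: leIl.
by apply: ubu; exists a => //; exact: meetxx.
Qed.

End ClosedIdeals.

Section RegularSublattice.
Local Open Scope order_scope.
Context {d d' : Order.disp_t} {L : latticeType d} {S : {pred L}}.
Context {Y : subLattice S d'} (hY : regular_sublattice Y).
Implicit Types (A : set Y) (x s : Y).

Lemma regular_supremumsP A s :
  supremums A s <-> supremums [set val a | a in A] (val s).
Proof.
split=> [|[ubs lbs]]; first exact: hY.1.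
split=> [a Aa|u ubu]; rewrite -Order.le_val.
  by apply: ubs; exists a.
by apply: lbs => _ [a Aa <-]; rewrite Order.le_val ubu.
Qed.

Lemma val_image_meet A x :
  [set val y | y in [set Order.meet x a | a in A]] =
  [set Order.meet (val x) b | b in [set val a | a in A]].
Proof.
by rewrite !image_comp; apply: eq_imagel => a _ /=; rewrite Order.valI_subproof.
Qed.

Lemma regular_meet_distributive :
  @meet_distributive d L -> @meet_distributive d' Y.
Proof.
move=> distr A s x /regular_supremumsP supA; apply/regular_supremumsP.
by rewrite val_image_meet Order.valI_subproof; apply: distr.
Qed.

Lemma sigma_ideal_val A x : @meet_distributive d L ->
  sigma_ideal A x <-> sigma_ideal [set val a | a in A] (val x).
Proof.
move=> distr; rewrite (sigma_ideal_meetP _ _ distr) -val_image_meet.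
rewrite (sigma_ideal_meetP _ _ (regular_meet_distributive distr)).
exact: regular_supremumsP.
Qed.

End RegularSublattice.

Theorem proposition3p7 (d d' : Order.disp_t) (L : latticeType d)
    (S : {pred L}) (Y : subLattice S d')
    (hL : infinitely_distributive L) (hY : regular_sublattice Y) (A : set Y) :
  [set val x | x in sigma_ideal A]
    = sigma_ideal [set val a | a in A] `&` [set` S] /\
  sigma_ideal [set val x | x in sigma_ideal A]
    = sigma_ideal [set val a | a in A].
Proof.
have eqY : [set val x | x in sigma_ideal A]
    = sigma_ideal [set val a | a in A] `&` [set` S].
  apply/seteqP; split=> [_ [x Ax <-]|y [Ay Sy]].
  - by split; [apply/(sigma_ideal_val hY _ _ hL.1)|exact: (valP x)].
  - exists (Sub y Sy : Y); last exact: SubK.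
    by apply/(sigma_ideal_val hY _ _ hL.1); rewrite SubK.
split=> //; apply/seteqP; split=> y Ay J [JO AJ]; apply: Ay; split=> //.
- by rewrite eqY => z [Az _]; apply: Az.
- by move=> _ [a Aa <-]; apply: AJ; exists a => //; exact: sub_gen_smallest.
Qed.
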